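(* (Progress, very busy expressions.) Let $P$ be a program, let $(\beta_{\bullet l},\beta_{l\bullet})_{l}$ be the very busy expressions analysis result for $P$, let $\rightarrow$ be the standard execution relation of $P$ and $\Rightarrow$ the very-busy-expressions augmented execution relation of $P$. For all labels $l,l'$ and states $\sigma,\sigma'$: if $\langle l,\sigma\rangle\rightarrow\langle l',\sigma'\rangle$, then $\langle l,\sigma,\beta_{\bullet l}\rangle\Rightarrow\langle l',\sigma',\beta_{\bullet l'}\rangle$.
   Context: Language. $N$ is the set of integers, $T=\{\mathbf{true},\mathbf{false}\}$, $V$ a set of variables, $L$ a set of labels. Arithmetic expressions $E$: $e::=n\mid v\mid e_0+e_1\mid e_0-e_1\mid e_0\times e_1$ ($n\in N$, $v\in V$). Boolean expressions $B$: $b::=\mathbf{true}\mid\mathbf{false}\mid e_0=e_1\mid e_0\le e_1\mid\mathbf{not}\,b\mid b_0\,\mathbf{and}\,b_1\mid b_0\,\mathbf{or}\,b_1$. Commands: $c::=\mathbf{skip}\mid v:=e\mid\mathbf{if}\,b\,\mathbf{then}\,g\mid\mathbf{goto}\,g\mid\mathbf{halt}\mid\mathbf{done}$ ($g\in L$). $\mathbf{vars}(e)$ is the set of variables occurring in $e$. $\mathbf{subs}(e)\subseteq E$ is the set of subexpressions of $e$ (including $e$ itself); $\mathbf{subs}(b)\subseteq E$ is the set of arithmetic expressions occurring as subexpressions in $b$. A program $P$ is a sequence of labeled commands $l:c$ with pairwise distinct labels; $\mathbf{next}(l)$ is the label of the command following $l$ in the sequence. If $l:\mathbf{halt}\in P$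 then $\mathbf{next}(l):\mathbf{done}\in P$. Branch targets $g$, and $\mathbf{next}(l)$ for each assignment, $\mathbf{skip}$, $\mathbf{if}$ or $\mathbf{halt}$ command at $l$, are labels of $P$. Successors: $\mathbf{succ}(l)=\{\mathbf{next}(l)\}$ for assignment, $\mathbf{skip}$, $\mathbf{halt}$; $\{g\}$ for $\mathbf{goto}\,g$; $\{\mathbf{next}(l),g\}$ for $\mathbf{if}\,b\,\mathbf{then}\,g$. Standard semantics. A state is a partial function $\sigma:V\rightharpoonup N$ with domain $\mathrm{dom}\,\sigma$. The evaluation relations $\langle e,\sigma\rangle\rightarrow n$ and $\langle b,\sigma\rangle\rightarrow t$ are the least relations with: constants evaluate to themselves; $\langle v,\sigma\rangle\rightarrow\sigma(v)$ if $v\in\mathrm{dom}\,\sigma$; a compound expression evaluates to the result of applying its operator to the values of all of its immediate subexpressions, provided all of these evaluate (no short-circuiting). The relation $\langle l,\sigma\rangle\rightarrow\langle l',\sigma'\rangle$ is the least relation with: if $l:v:=e\in P$ and $\langle e,\sigma\rangle\rightarrow n$, then $\langle l,\sigma\rangle\rightarrow\langle\mathbf{next}(l),\sigma[v\mapsto n]\rangle$; if $l:\mathbf{if}\,b\,\mathbf{then}\,g\in P$, then $\langle l,\sigma\rangle\rightarrow\langle g,\sigma\rangle$ when $\langle b,\sigma\rangle\rightarrow\mathbf{true}$ and $\langle l,\sigma\rangle\rightarrow\langle\mathbf{next}(l),\sigma\rangle$ when $\langle b,\sigma\rangle\rightarrow\mathbf{false}$; if $l:\mathbf{goto}\,g\in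 P$, then $\langle l,\sigma\rangle\rightarrow\langle g,\sigma\rangle$; if $l:\mathbf{skip}\in P$, or $l:\mathbf{halt}\in P$ and $\mathbf{next}(l):\mathbf{done}\in P$, then $\langle l,\sigma\rangle\rightarrow\langle\mathbf{next}(l),\sigma\rangle$. Very-busy-expressions augmented semantics. The prophecy variable is a set $\pi\subseteq E$. Evaluation $\langle e,\sigma,\pi\rangle\Rightarrow n$, $\langle b,\sigma,\pi\rangle\Rightarrow t$ is defined by exactly the standard rules with $\pi$ carried along unchanged. The relation $\langle l,\sigma,\pi\rangle\Rightarrow\langle l',\sigma',\pi'\rangle$ is the least relation with: if $l:v:=e\in P$, $\langle e,\sigma,\pi\rangle\Rightarrow n$, every $e'\in\pi$ satisfies $e'\in\mathbf{subs}(e)$ or $v\notin\mathbf{subs}(e')$, and $\pi'\supseteq\pi\setminus\mathbf{subs}(e)$, then $\langle l,\sigma,\pi\rangle\Rightarrow\langle\mathbf{next}(l),\sigma[v\mapsto n],\pi'\rangle$; if $l:\mathbf{if}\,b\,\mathbf{then}\,g\in P$ and $\pi'\supseteq\pi\setminus\mathbf{subs}(b)$, then $\langle l,\sigma,\pi\rangle\Rightarrow\langle g,\sigma,\pi'\rangle$ when $\langle b,\sigma,\pi\rangle\Rightarrow\mathbf{true}$ and $\langle l,\sigma,\pi\rangle\Rightarrow\langle\mathbf{next}(l),\sigma,\pi'\rangle$ when $\langle b,\sigma,\pi\rangle\Rightarrow\mathbf{false}$; if $l:\mathbf{goto}\,g\in P$, then $\langle l,\sigma,\pi\rangle\Rightarrow\langle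 g,\sigma,\pi\rangle$; if $l:\mathbf{skip}\in P$, then $\langle l,\sigma,\pi\rangle\Rightarrow\langle\mathbf{next}(l),\sigma,\pi\rangle$; if $l:\mathbf{halt}\in P$, $\mathbf{next}(l):\mathbf{done}\in P$ and $\pi=\emptyset$, then $\langle l,\sigma,\pi\rangle\Rightarrow\langle\mathbf{next}(l),\sigma,\pi\rangle$. Very busy expressions analysis. $\beta_{\bullet l},\beta_{l\bullet}\subseteq E$, for $l$ ranging over the labels of $P$, are the least solution with respect to componentwise reverse inclusion $\supseteq$ (i.e. the solution with the largest sets) of the equations: $\beta_{l\bullet}=\emptyset$ if $l:\mathbf{done}\in P$; $\beta_{l\bullet}=\bigcap_{g\in\mathbf{succ}(l)}\beta_{\bullet g}$ for all other labels $l$; $\beta_{\bullet l}=f(l,\beta_{l\bullet})$, where $f(l,\beta)=(\beta\setminus\{e'\in\beta: v\in\mathbf{vars}(e')\})\cup\mathbf{subs}(e)$ if $l:v:=e\in P$, $f(l,\beta)=\beta\cup\mathbf{subs}(b)$ if $l:\mathbf{if}\,b\,\mathbf{then}\,g\in P$, and $f(l,\beta)=\beta$ otherwise. *)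

(* Defs.v *)
From HB Require Import structures.
From mathcomp Require Import all_boot all_order all_algebra.
From mathcomp Require Import boolp classical_sets.

Set Implicit Arguments.
Unset Strict Implicit.
Unset Printing Implicit Defensive.

Local Open Scope classical_set_scope.

Inductive aexp (V : Type) : Type :=
| Const of int
| Var of V
| Add of aexp V & aexp V
| Sub of aexp V & aexp V
| Mul of aexp V & aexp V.

Arguments Const {V}.

Inductive bexp (V : Type) : Type :=
| BTrue
| BFalse
| BEq of aexp V & aexp V
| BLe of aexp V & aexp V
| BNot of bexp V
| BAnd of bexp V & bexp V
| BOr of bexp V & bexp V.

Arguments BTrue {V}.
Arguments BFalse {V}.

Inductive cmd (V L : Type) : Type :=
| Skip
| Assign of V & aexp V
| IfThen of bexp V & L
| Goto of L
| Halt
| Done.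

Arguments Skip {V L}.
Arguments Assign {V L}.
Arguments IfThen {V L}.
Arguments Goto {V L}.
Arguments Halt {V L}.
Arguments Done {V L}.

(* Classical decidable equality, so that membership of [(l, c)] in a list of
   labeled commands can be written with [\in]. *)
HB.instance Definition _ (V L : Type) := gen_eqMixin (cmd V L).

Fixpoint vars (V : Type) (e : aexp V) : set V :=
  match e with
  | Const _ => set0
  | Var v => [set v]
  | Add e0 e1 | Sub e0 e1 | Mul e0 e1 => vars e0 `|` vars e1
  end.

Fixpoint subs (V : Type) (e : aexp V) : set (aexp V) :=
  [set e] `|`
  match e with
  | Const _ | Var _ => set0
  | Add e0 e1 | Sub e0 e1 | Mul e0 e1 => subs e0 `|` subs e1
  end.

Fixpoint bsubs (V : Type) (b : bexp V) : set (aexp V) :=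
  match b with
  | BTrue | BFalse => set0
  | BEq e0 e1 | BLe e0 e1 => subs e0 `|` subs e1
  | BNot b0 => bsubs b0
  | BAnd b0 b1 | BOr b0 b1 => bsubs b0 `|` bsubs b1
  end.

Section Programs.
Variables V L : eqType.
Implicit Types (P : seq (L * cmd V L)) (l g : L) (c : cmd V L).

Definition labels P : seq L := unzip1 P.

(* [None] when [l] is the last label of [P] or is not a label of [P]. *)
Definition next P l : option L := onth (labels P) (index l (labels P)).+1.

Definition falls_through c : bool :=
  match c with
  | Skip | Assign _ _ | IfThen _ _ | Halt => true
  | Goto _ | Done => false
  end.

Definition target c : option L :=
  match c with
  | IfThen _ g | Goto g => Some g
  | Skip | Assign _ _ | Halt | Done => None
  end.

Record wf_program P : Prop := {
  wf_uniq : uniq (labels P);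
  wf_halt : forall l, (l, Halt) \in P ->
    exists2 l', next P l = Some l' & (l', Done) \in P;
  wf_target : forall l c g, (l, c) \in P -> target c = Some g ->
    g \in labels P;
  wf_next : forall l c, (l, c) \in P -> falls_through c ->
    exists2 l', next P l = Some l' & l' \in labels P
}.

(* [Done] has no successors; the analysis never uses that case. *)
Definition succ P l : set L :=
  [set l' | exists2 c, (l, c) \in P &
    match c with
    | Skip | Assign _ _ | Halt => next P l = Some l'
    | Goto g => l' = g
    | IfThen _ g => next P l = Some l' \/ l' = g
    | Done => False
    end].

End Programs.

(* A partial function; [None] outside of its domain. *)
Definition state (V : Type) : Type := V -> option int.

Definition update (V : eqType) (s : state V) (v : V) (n : int) : state V :=
  fun w => if w == v then Some n else s w.

Section Standard.
Variables V L : eqType.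

Inductive aeval (s : state V) : aexp V -> int -> Prop :=
| AConst n : aeval s (Const n) n
| AVar v n : s v = Some n -> aeval s (Var v) n
| AAdd e0 e1 n0 n1 : aeval s e0 n0 -> aeval s e1 n1 ->
    aeval s (Add e0 e1) (n0 + n1)%R
| ASub e0 e1 n0 n1 : aeval s e0 n0 -> aeval s e1 n1 ->
    aeval s (Sub e0 e1) (n0 - n1)%R
| AMul e0 e1 n0 n1 : aeval s e0 n0 -> aeval s e1 n1 ->
    aeval s (Mul e0 e1) (n0 * n1)%R.

Inductive beval (s : state V) : bexp V -> bool -> Prop :=
| BevTrue : beval s BTrue true
| BevFalse : beval s BFalse false
| BevEq e0 e1 n0 n1 : aeval s e0 n0 -> aeval s e1 n1 ->
    beval s (BEq e0 e1) (n0 == n1)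
| BevLe e0 e1 n0 n1 : aeval s e0 n0 -> aeval s e1 n1 ->
    beval s (BLe e0 e1) (n0 <= n1)%R
| BevNot b0 t0 : beval s b0 t0 -> beval s (BNot b0) (~~ t0)
| BevAnd b0 b1 t0 t1 : beval s b0 t0 -> beval s b1 t1 ->
    beval s (BAnd b0 b1) (t0 && t1)
| BevOr b0 b1 t0 t1 : beval s b0 t0 -> beval s b1 t1 ->
    beval s (BOr b0 b1) (t0 || t1).

Inductive step (P : seq (L * cmd V L)) : L * state V -> L * state V -> Prop :=
| StepAssign l l' v e s n :
    (l, Assign v e) \in P -> next P l = Some l' -> aeval s e n ->
    step P (l, s) (l', update s v n)
| StepIfTrue l b g s :
    (l, IfThen b g) \in P -> beval s b true ->
    step P (l, s) (g, s)
| StepIfFalse l l' b g s :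
    (l, IfThen b g) \in P -> next P l = Some l' -> beval s b false ->
    step P (l, s) (l', s)
| StepGoto l g s :
    (l, Goto g) \in P ->
    step P (l, s) (g, s)
| StepSkip l l' s :
    (l, Skip) \in P -> next P l = Some l' ->
    step P (l, s) (l', s)
| StepHalt l l' s :
    (l, Halt) \in P -> next P l = Some l' -> (l', Done) \in P ->
    step P (l, s) (l', s).

End Standard.

Section VeryBusyAugmented.
Variables V L : eqType.

Inductive vb_aeval (s : state V) (pi : set (aexp V)) : aexp V -> int -> Prop :=
| VBAConst n : vb_aeval s pi (Const n) n
| VBAVar v n : s v = Some n -> vb_aeval s pi (Var v) n
| VBAAdd e0 e1 n0 n1 : vb_aeval s pi e0 n0 -> vb_aeval s pi e1 n1 ->
    vb_aeval s pi (Add e0 e1) (n0 + n1)%R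
| VBASub e0 e1 n0 n1 : vb_aeval s pi e0 n0 -> vb_aeval s pi e1 n1 ->
    vb_aeval s pi (Sub e0 e1) (n0 - n1)%R
| VBAMul e0 e1 n0 n1 : vb_aeval s pi e0 n0 -> vb_aeval s pi e1 n1 ->
    vb_aeval s pi (Mul e0 e1) (n0 * n1)%R.

Inductive vb_beval (s : state V) (pi : set (aexp V)) : bexp V -> bool -> Prop :=
| VBBTrue : vb_beval s pi BTrue true
| VBBFalse : vb_beval s pi BFalse false
| VBBEq e0 e1 n0 n1 : vb_aeval s pi e0 n0 -> vb_aeval s pi e1 n1 ->
    vb_beval s pi (BEq e0 e1) (n0 == n1)
| VBBLe e0 e1 n0 n1 : vb_aeval s pi e0 n0 -> vb_aeval s pi e1 n1 ->
    vb_beval s pi (BLe e0 e1) (n0 <= n1)%R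
| VBBNot b0 t0 : vb_beval s pi b0 t0 -> vb_beval s pi (BNot b0) (~~ t0)
| VBBAnd b0 b1 t0 t1 : vb_beval s pi b0 t0 -> vb_beval s pi b1 t1 ->
    vb_beval s pi (BAnd b0 b1) (t0 && t1)
| VBBOr b0 b1 t0 t1 : vb_beval s pi b0 t0 -> vb_beval s pi b1 t1 ->
    vb_beval s pi (BOr b0 b1) (t0 || t1).

Inductive vb_step (P : seq (L * cmd V L)) :
  L * state V * set (aexp V) -> L * state V * set (aexp V) -> Prop :=
| VBStepAssign l l' v e s n (pi pi' : set (aexp V)) :
    (l, Assign v e) \in P -> next P l = Some l' -> vb_aeval s pi e n ->
    (forall e', pi e' -> subs e e' \/ ~ subs e' (Var v)) ->
    pi `\` subs e `<=` pi' ->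
    vb_step P (l, s, pi) (l', update s v n, pi')
| VBStepIfTrue l b g s (pi pi' : set (aexp V)) :
    (l, IfThen b g) \in P -> pi `\` bsubs b `<=` pi' ->
    vb_beval s pi b true ->
    vb_step P (l, s, pi) (g, s, pi')
| VBStepIfFalse l l' b g s (pi pi' : set (aexp V)) :
    (l, IfThen b g) \in P -> next P l = Some l' ->
    pi `\` bsubs b `<=` pi' -> vb_beval s pi b false ->
    vb_step P (l, s, pi) (l', s, pi')
| VBStepGoto l g s pi :
    (l, Goto g) \in P ->
    vb_step P (l, s, pi) (g, s, pi)
| VBStepSkip l l' s pi :
    (l, Skip) \in P -> next P l = Some l' ->
    vb_step P (l, s, pi) (l', s, pi)
| VBStepHalt l l' s pi :
    (l, Halt) \in P -> next P l = Some l' -> (l', Done) \in P -> pi = set0 ->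
    vb_step P (l, s, pi) (l', s, pi).

End VeryBusyAugmented.

Section VeryBusyAnalysis.
Variables V L : eqType.
Implicit Types (P : seq (L * cmd V L)) (bin bout : L -> set (aexp V)).

Definition vb_transfer (c : cmd V L) (B : set (aexp V)) : set (aexp V) :=
  match c with
  | Assign v e => (B `\` [set e' | B e' /\ vars e' v]) `|` subs e
  | IfThen b _ => B `|` bsubs b
  | Skip | Goto _ | Halt | Done => B
  end.

(* [bin l] and [bout l] are the sets before and after [l].  Only their values
   at labels of [P] are constrained. *)
Definition vb_solution P bin bout : Prop :=
  forall l c, (l, c) \in P ->
    bout l = match c with
             | Done => set0
             | _ => \bigcap_(g in succ P l) bin g
             end
    /\ bin l = vb_transfer c (bout l).

(* Least for componentwise reverse inclusion, that is, the solution with the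
   largest sets. *)
Definition vb_analysis P bin bout : Prop :=
  vb_solution P bin bout /\
  forall bin' bout', vb_solution P bin' bout' ->
    forall l, l \in labels P -> bin' l `<=` bin l /\ bout' l `<=` bout l.

End VeryBusyAnalysis.

(* Main.v *)
(* After an assignment or a conditional, [bout l] is contained in [bin l'], and
   [bin l] minus the subexpressions just evaluated is contained in [bout l].
   The other commands leave [pi] unchanged and thus need [bin l = bin l'], which
   holds because labels are distinct, so that [l] has exactly one successor. *)
Require Import Defs.
From mathcomp Require Import all_boot all_order all_algebra.
From mathcomp Require Import boolp classical_sets.

Set Implicit Arguments.
Unset Strict Implicit.
Unset Printing Implicit Defensive.

Local Open Scope classical_set_scope.

(** With distinct labels, this identifies the command hidden behind the existential in [succ]. *)
Lemma uniq_unzip1_inj (A B : eqType) (s : seq (A * B)) (a : A) (b b' : B) :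
  uniq (unzip1 s) -> (a, b) \in s -> (a, b') \in s -> b = b'.
Proof.
have key x y t : (x, y) \in t -> x \in unzip1 t.
  by move=> xy; apply/mapP; exists (x, y).
elim: s => //= -[x y] s IH /andP[xs us]; rewrite !inE.
move=> /orP[/eqP[ax ->]|sb] /orP[/eqP[ax' ->]|sb'] //.
- by move: xs; rewrite -ax (key _ _ _ _ _ sb').
- by move: xs; rewrite -ax' (key _ _ _ _ _ sb).
- exact: IH.
Qed.

(** Links the two ways of saying that an assignment to [v] affects an expression: the analysis kills
    through [vars], the augmented semantics tests [Var v] against [subs]. *)
Lemma subs_Var_vars (V : Type) (e : aexp V) (v : V) :
  subs e (Var v) -> vars e v.
Proof.
elim: e => [n|w|e0 I0 e1 I1|e0 I0 e1 I1|e0 I0 e1 I1] /= [] //.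
- by case.
- by case=> [/I0|/I1]; [left|right].
- by case=> [/I0|/I1]; [left|right].
- by case=> [/I0|/I1]; [left|right].
Qed.

Lemma aeval_vb_aeval (V : eqType) (s : state V) (pi : set (aexp V)) e n :
  aeval s e n -> vb_aeval s pi e n.
Proof. by elim=> *; constructor. Qed.

Lemma beval_vb_beval (V : eqType) (s : state V) (pi : set (aexp V)) b t :
  beval s b t -> vb_beval s pi b t.
Proof. by elim=> *; constructor => //; exact: aeval_vb_aeval. Qed.

Section Solution.
Variables (V L : eqType) (P : seq (L * cmd V L)) (bin bout : L -> set (aexp V)).
Hypothesis uniqP : uniq (labels P).
Hypothesis solP : vb_solution P bin bout.

(** An intersection lies in each of its members; [Done], whose [bout] is [set0] instead, has no
    successor. *)
Lemma succ_bout_sub_bin l l' : succ P l l' -> bout l `<=` bin l'.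
Proof.
move=> ll'; have [c lc Hc] := ll'.
by have [-> _] := solP lc; case: c {lc} Hc => //= *; exact: bigcap_inf.
Qed.

Lemma succ1_bout_eq_bin l l' c : (l, c) \in P -> c <> Done ->
  succ P l = [set l'] -> bout l = bin l'.
Proof.
move=> lc cD Sl; have [-> _] := solP lc; rewrite Sl bigcap_set1.
by case: c cD {lc}.
Qed.

(* [Defs.next] is shadowed by [next] from mathcomp's [path]. *)
Lemma succ_next l l' c : (l, c) \in P ->
  match c with Skip | Assign _ _ | Halt => true | _ => false end ->
  Defs.next P l = Some l' -> succ P l = [set l'].
Proof.
move=> lc Hc Hn; apply/seteqP; split=> x /=.
  case=> c' lc'; rewrite -(uniq_unzip1_inj uniqP lc lc').
  by case: c Hc {lc} => //= *; apply/esym; apply: Some_inj; rewrite -Hn.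
by move=> ->; exists c => //; case: c Hc {lc}.
Qed.

Lemma succ_Goto l g : (l, Goto g) \in P -> succ P l = [set g].
Proof.
move=> lc; apply/seteqP; split=> x /=; last by exists (Goto g).
by case=> c' lc'; rewrite -(uniq_unzip1_inj uniqP lc lc').
Qed.

Lemma vb_solution_step x y :
  step P x y -> vb_step P (x, bin x.1) (y, bin y.1).
Proof.
case=> /=.
- move=> l1 l2 v e s1 n lc nl ev.
  have [_ binE] := solP lc; rewrite /= in binE.
  apply: (VBStepAssign lc nl (aeval_vb_aeval _ ev)) => [e'|].
    (* An element of [bin l1] either survived the kill, hence does not mention [v], or was generated
       by [e]. *)
    rewrite binE => -[[b nv]|]; last by left.
    by right=> vsub; apply: nv; split=> //; exact: subs_Var_vars.
  rewrite binE => e' [[[b _] _|//]].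
  by apply: (succ_bout_sub_bin _ b); exists (Assign v e).
- move=> l1 b g s1 lc ev.
  have [_ /= binE] := solP lc.
  apply: (VBStepIfTrue lc _ (beval_vb_beval _ ev)).
  rewrite binE => e' [[B _|//]].
  by apply: (succ_bout_sub_bin _ B); exists (IfThen b g) => //; right.
- move=> l1 l2 b g s1 lc nl ev.
  have [_ /= binE] := solP lc.
  apply: (VBStepIfFalse lc nl _ (beval_vb_beval _ ev)).
  rewrite binE => e' [[B _|//]].
  by apply: (succ_bout_sub_bin _ B); exists (IfThen b g) => //; left.
- move=> l1 g s1 lc.
  have [_ /= ->] := solP lc.
  rewrite (succ1_bout_eq_bin lc _ (succ_Goto lc)) //.
  exact: VBStepGoto.
- move=> l1 l2 s1 lc nl.
  have [_ /= ->] := solP lc.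
  rewrite (succ1_bout_eq_bin lc _ (succ_next lc _ nl)) //.
  exact: VBStepSkip.
- move=> l1 l2 s1 lc nl ld.
  have [_ /= ->] := solP lc.
  rewrite (succ1_bout_eq_bin lc _ (succ_next lc _ nl)) //.
  (* The prophecy is now [bin l2], which has to be empty: [Done] at [l2] gives [bout l2 = set0], and
     its transfer function is the identity. *)
  apply: VBStepHalt => //.
  by have [boutE /= ->] := solP ld.
Qed.

End Solution.

Unset Implicit Arguments.

Theorem theorem4p17 (V L : eqType) (P : seq (L * cmd V L))
    (bin bout : L -> set (aexp V)) (l l' : L) (s s' : state V) :
  wf_program P -> vb_analysis P bin bout ->
  step P (l, s) (l', s') -> vb_step P (l, s, bin l) (l', s', bin l').
Proof.
move=> wfP [solP _]; exact: (vb_solution_step (wf_uniq wfP) solP).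
Qed.
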